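(* Let $p,q\ge 1$ be coprime integers and let $S$ be the set of pairs $(\alpha,\beta)\in\mathbb{R}^2$ such that $\lfloor \alpha \lfloor \beta x\rfloor\rfloor \ge \lfloor \beta \lfloor \alpha x\rfloor\rfloor$ for all $x\in\mathbb{R}$. For each integer $r\ge 1$ define $$\Phi_p^r(\beta):=\frac{r\beta}{(1-r)p\beta+1}.$$ Then $\Phi_p^r$ maps the set $\{\beta<0 : (-\tfrac qp,\beta)\in S\}$ into itself; that is, if $\beta<0$ and $(-\frac qp,\beta)\in S$, then $\Phi_p^r(\beta)<0$ and $(-\frac qp,\Phi_p^r(\beta))\in S$.
   Context: $\lfloor x\rfloor$ denotes the floor function (largest integer $\le x$). *)

(* Defs.v *)
From mathcomp Require Import all_boot all_order all_algebra.
From mathcomp Require Import boolp classical_sets reals.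

Set Implicit Arguments.
Unset Strict Implicit.
Unset Printing Implicit Defensive.

Import Order.TTheory GRing.Theory Num.Theory.

Local Open Scope classical_set_scope.
Local Open Scope ring_scope.

Definition floorS {R : realType} : set (R * R) :=
  [set ab | forall x : R,
     Num.floor (ab.1 * (Num.floor (ab.2 * x))%:~R) >=
     Num.floor (ab.2 * (Num.floor (ab.1 * x))%:~R)].

(* The denominator is at least 1 when beta < 0 and r >= 1, so on the domain
   of interest the convention 0^-1 = 0 plays no role. *)
Definition Phi (R : realType) (p r : nat) (beta : R) : R :=
  (r%:R * beta) / ((1 - r%:R) * p%:R * beta + 1).

(* Main.v *)
(** For negative [alpha] and [beta], membership of [(alpha, beta)] in [S] says
    that whenever [alpha * j] lies strictly below an integer [n], some integer
    multiple of [beta] lies in [[alpha * j, n[].  For [alpha = - q / p], solving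
    for that multiple turns the criterion into the existence of an integer in
    [[u * (alpha * j), u * n + d[], where [u = - 1 / beta - p] is [Phi_coord]
    and [d = p * n + q * j] is a positive integer.  The map [Phi p r] divides
    [u] by [r], and if [m] is an integer for [u] then [m / r] rounded up is one
    for [u / r]: rounding costs at most [(r - 1) / r <= d - d / r]. *)
Require Import Defs.
From mathcomp Require Import all_boot all_order all_algebra.
From mathcomp Require Import reals.
From mathcomp Require Import ring lra zify.

Set Implicit Arguments.
Unset Strict Implicit.
Unset Printing Implicit Defensive.

Import Order.TTheory GRing.Theory Num.Theory.

Local Open Scope ring_scope.

Lemma nmulr_floor_ltP (R : archiRealDomainType) (b y z : R) : b < 0 ->
  b * (Num.floor y)%:~R < z <-> exists2 k : int, k%:~R <= y & b * k%:~R < z.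
Proof.
move=> b_lt0; split=> [floor_lt|[k k_le_y bk_lt]].
  by exists (Num.floor y) => //; exact: floor_le.
by apply: le_lt_trans bk_lt; rewrite ler_nM2l// ler_int floor_ge_int.
Qed.

Lemma ceil_div_le (R : archiRealFieldType) (m : int) (r : nat) : (0 < r)%N ->
  (Num.ceil (m%:~R / r%:R : R))%:~R * r%:R <= m%:~R + (r%:R - 1) :> R.
Proof.
move=> r_gt0; set c := Num.ceil _.
have : (c - 1)%:~R < m%:~R / r%:R :> R by exact: ceilB1_lt.
rewrite ltr_pdivlMr ?ltr0n// -[r%:R]/(r%:Z%:~R) -rmorphM ltr_int => c_lt.
have : c * r%:Z <= m + (r%:Z - 1) by lia.
by rewrite -(ler_int R) !(rmorphD, rmorphM, rmorphN).
Qed.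

Lemma exists_int_itv_div (R : archiRealFieldType) (a b d : R) (r : nat) :
    (0 < r)%N -> 1 <= d ->
    (exists m : int, a <= m%:~R < b + d) ->
  exists m : int, a / r%:R <= m%:~R < b / r%:R + d.
Proof.
move=> r_gt0 d_ge1 [m /andP[a_le m_lt]]; exists (Num.ceil (m%:~R / r%:R : R)).
have r_gt0R : 0 < r%:R :> R by rewrite ltr0n.
have r_ge1 : 1 <= r%:R :> R by rewrite ler1n.
apply/andP; split.
  by apply: le_trans (ceil_ge _); rewrite ler_pM2r// invr_gt0.
rewrite -(ltr_pM2r r_gt0R) mulrDl mulfVK ?gt_eqF//.
apply: le_lt_trans (ceil_div_le _ _ r_gt0) _.
have : (r%:R - 1) * 1 <= (r%:R - 1) * d by rewrite ler_wpM2l// subr_ge0.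
lra.
Qed.

Lemma Phi_lt0 (R : realType) (p r : nat) (beta : R) :
  (0 < r)%N -> beta < 0 -> Phi p r beta < 0.
Proof.
move=> r_gt0 beta_lt0; rewrite /Phi pmulr_llt0 ?pmulr_rlt0 ?ltr0n// invr_gt0.
by rewrite ltr_wpDl// mulr_le0 ?(ltW beta_lt0)// mulr_le0_ge0 ?subr_le0 ?ler1n.
Qed.

Definition Phi_coord (R : fieldType) (p : nat) (beta : R) : R :=
  - beta^-1 - p%:R.

Lemma Phi_coord_Phi (R : realType) (p r : nat) (beta : R) :
    (0 < r)%N -> beta != 0 ->
  Phi_coord p (Phi p r beta) = Phi_coord p beta / r%:R.
Proof.
move=> r_gt0 beta_neq0; rewrite /Phi_coord /Phi invf_div.
by field; rewrite beta_neq0 pnatr_eq0 -lt0n r_gt0.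
Qed.

Lemma Phi_coord_itvE (R : realFieldType) (p : nat) (beta x y k : R) :
    beta < 0 ->
  (x <= beta * k < y) =
  (Phi_coord p beta * x <= - (p%:R * x) - k <
     Phi_coord p beta * y + p%:R * (y - x)).
Proof.
move=> beta_lt0; have beta_neq0 : beta != 0 by rewrite lt_eqF.
have lower_gapE :
    - (p%:R * x) - k - Phi_coord p beta * x = (x - beta * k) / beta.
  by rewrite /Phi_coord; field.
have upper_gapE : Phi_coord p beta * y + p%:R * (y - x) - (- (p%:R * x) - k) =
    (beta * k - y) / beta.
  by rewrite /Phi_coord; field.
rewrite -[_ * x <= _]subr_ge0 -[_ - k < _]subr_gt0 lower_gapE upper_gapE.
by rewrite nmulr_lge0 ?nmulr_lgt0 ?invr_lt0// subr_le0 subr_lt0.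
Qed.

Section FloorSCriteria.
Variable R : realType.
Implicit Types alpha beta : R.

Lemma floorS_ltP alpha beta :
  floorS (alpha, beta) <->
  (forall (x : R) (n : int), alpha * (Num.floor (beta * x))%:~R < n%:~R ->
     beta * (Num.floor (alpha * x))%:~R < n%:~R).
Proof.
split=> [S x n|lt_imp x /=].
  by rewrite -!floor_lt_int; apply: le_lt_trans (S x).
by rewrite -ltzD1 floor_lt_int; apply/lt_imp/floorD1_gt.
Qed.

Lemma floorS_negP alpha beta : alpha < 0 -> beta < 0 ->
  floorS (alpha, beta) <->
  (forall j n : int, alpha * j%:~R < n%:~R ->
     exists k : int, alpha * j%:~R <= beta * k%:~R < n%:~R).
Proof.
move=> alpha_lt0 beta_lt0; rewrite floorS_ltP.
split=> [lt_imp j n aj_lt|itv x n].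
  have bx : beta * (j%:~R / beta) = j%:~R by rewrite mulrC divfK// lt_eqF.
  have := lt_imp (j%:~R / beta) n.
  rewrite bx intrKfloor => /(_ aj_lt).
  move=> /(nmulr_floor_ltP _ _ beta_lt0)[k k_le bk].
  by exists k; rewrite bk andbT -ler_ndivlMl// mulrC -mulrA.
move=> /itv[k /andP[aj_le bk]]; apply/nmulr_floor_ltP => //; exists k => //.
rewrite -(ler_nM2l beta_lt0) mulrCA; apply: le_trans aj_le.
by rewrite ler_nM2l// floor_le.
Qed.

Lemma floorS_Phi_coordP (p q : nat) beta :
    (0 < p)%N -> (0 < q)%N -> beta < 0 ->
  floorS (- (q%:R / p%:R), beta) <->
  (forall j n : int, 0 < p%:Z * n + q%:Z * j ->
     exists m : int, Phi_coord p beta * (- (q%:R / p%:R) * j%:~R) <= m%:~R <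
       Phi_coord p beta * n%:~R + (p%:Z * n + q%:Z * j)%:~R).
Proof.
move=> p_gt0 q_gt0 beta_lt0; set alpha := - _.
have p_gt0R : 0 < p%:R :> R by rewrite ltr0n.
have alpha_lt0 : alpha < 0 by rewrite oppr_lt0 divr_gt0 ?ltr0n.
have qE (j : int) : (q%:Z * j)%:~R = - (p%:R * (alpha * j%:~R)) :> R.
  by rewrite rmorphM/= -pmulrn /alpha; field; rewrite gt_eqF.
have dE (j n : int) :
    (p%:Z * n + q%:Z * j)%:~R = p%:R * (n%:~R - alpha * j%:~R) :> R.
  by rewrite rmorphD /= qE rmorphM/= -pmulrn mulrBr.
have d_gt0 (j n : int) : (0 < p%:Z * n + q%:Z * j) = (alpha * j%:~R < n%:~R).
  by rewrite -(ltr0z R) dE pmulr_rgt0// subr_gt0.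
have kE (j k : int) : (q%:Z * j - k)%:~R = - (p%:R * (alpha * j%:~R)) - k%:~R.
  by rewrite rmorphB/= qE.
rewrite floorS_negP//; split=> itv j n.
  rewrite d_gt0 => /itv[k k_itv]; exists (q%:Z * j - k).
  by rewrite dE kE -Phi_coord_itvE.
rewrite -d_gt0 => /itv[m m_itv]; exists (q%:Z * j - m).
by rewrite (Phi_coord_itvE p)// -kE -dE subKr.
Qed.

End FloorSCriteria.

Theorem theorem1p4 (R : realType) (p q : nat) (hp : (1 <= p)%N)
    (hq : (1 <= q)%N) (hpq : coprime p q) (r : nat) (hr : (1 <= r)%N)
    (beta : R) (hbeta : beta < 0) (hS : floorS (- (q%:R / p%:R), beta)) :
  Phi p r beta < 0 /\ floorS (- (q%:R / p%:R), Phi p r beta).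
Proof.
have Phi_neg : Phi p r beta < 0 by exact: Phi_lt0.
split=> //; apply/floorS_Phi_coordP => // j n d_gt0.
rewrite Phi_coord_Phi ?lt_eqF// ![_ / r%:R * _]mulrAC.
apply: exists_int_itv_div => //; first by rewrite ler1z -gtz0_ge1.
by have /floorS_Phi_coordP := hS; apply.
Qed.
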